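(* Let $\mathcal{I},\mathcal{I}_0$ be ideals on $\mathbb{N}$ such that $\mathcal{I}$ is a P($\mathcal{I}_0$)-ideal. Then $\mathcal{I}$ is not a Baire ideal.
   Context: An ideal on $\mathbb{N}$ is a family $\mathcal{I}\subset\mathcal{P}(\mathbb{N})$ with $\mathbb{N}\notin\mathcal{I}$, closed under subsets and finite unions; every ideal is assumed to contain the family $\mathrm{Fin}$ of all finite subsets of $\mathbb{N}$. $\mathcal{I}$ is a P($\mathcal{I}_0$)-ideal if: (I) for every sequence $(A_n)_{n\in\mathbb{N}}$ in $\mathcal{I}$ there is $A\in\mathcal{I}$ such that $A_n\setminus A\in\mathcal{I}_0$ for each $n\in\mathbb{N}$; and (II) for each $A\in\mathcal{I}$ there exists $B\in\mathcal{I}$ such that $B\setminus A\notin\mathcal{I}_0$. For a topological space $X$, $\mathrm{NWD}(X)$ is the family of nowhere dense subsets of $X$. $\mathcal{I}$ is a Baire ideal if for every complete metric space $X$ and every monotonic $f\colon\mathcal{I}\to\mathrm{NWD}(X)$ (i.e. $A\subset B$ implies $f(A)\subset f(B)$) one has $\bigcup\{f(A):A\in\mathcal{I}\}\neq X$. Metric spaces are assumed nonempty. *)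

(* Defs.v *)
From HB Require Import structures.
From mathcomp Require Import all_boot all_order all_algebra.
From mathcomp Require Import all_classical all_reals all_analysis.

Set Implicit Arguments.
Unset Strict Implicit.
Unset Printing Implicit Defensive.

Local Open Scope classical_set_scope.

Record is_ideal (I : set_system nat) : Prop := IsIdeal {
  ideal_setT : ~ I [set: nat];
  ideal_subset : forall A B, A `<=` B -> I B -> I A;
  ideal_setU : forall A B, I A -> I B -> I (A `|` B);
  ideal_finite : forall A, finite_set A -> I A }.

Record P_ideal (I0 I : set_system nat) : Prop := PIdeal {
  P_ideal_pseudounion : forall A : nat -> set nat, (forall n, I (A n)) ->
    exists2 B, I B & forall n, I0 (A n `\` B);
  P_ideal_unbounded : forall A, I A -> exists2 B, I B & ~ I0 (B `\` A) }.

(* The spaces of this type are nonempty, since [Complete] extends [Pointed]. *)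
#[short(type="completeMetricType")]
HB.structure Definition CompleteMetric (R : numDomainType) :=
  {T of Complete T & Metric R T}.

Definition nowhere_dense (X : topologicalType) (A : set X) : Prop :=
  interior (closure A) = set0.

(* A map from I to NWD(X) is encoded as a total function on subsets of nat of
   which only the values on I matter. *)
Definition Baire_ideal (R : realType) (I : set_system nat) : Prop :=
  forall (X : completeMetricType R) (f : set nat -> set X),
    (forall A, I A -> nowhere_dense (f A)) ->
    (forall A B, I A -> I B -> A `<=` B -> f A `<=` f B) ->
    \bigcup_(A in I) f A <> [set: X].

(* Main.v *)
(* The space of sequences of subsets of nat, each coordinate being discrete, is
   completely metrizable.  Given B in I, let f B be the set of the sequences all
   of whose members in I are contained in B modulo I0.  Condition (I) says that
   the sets f B cover the space.  A basic open set leaves all but finitely many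
   coordinates free, so by condition (II) some coordinate can be set to a C in I
   with C `\` B not in I0: the set f B is nowhere dense. *)

Require Import Defs.
From HB Require Import structures.
From mathcomp Require Import all_boot all_order all_algebra.
From mathcomp Require Import all_classical all_reals all_analysis.

Set Implicit Arguments.
Unset Strict Implicit.
Unset Printing Implicit Defensive.

Import Order.TTheory GRing.Theory Num.Theory.
Local Open Scope ring_scope.
Local Open Scope classical_set_scope.

Section sequence_metric.
Context {R : realType} {T : pointedType}.
Implicit Types x y z : nat -> T.

(* The inverse of the rank, counted from 1, of the first difference. *)
Definition seq_dist x y : R :=
  if pselect (exists n, `[< x n <> y n >]) is left xy
  then (ex_minn xy).+1%:R^-1 else 0.

Variant seq_dist_spec x y : R -> Prop :=
| SeqDistEq of x = y : seq_dist_spec x y 0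
| SeqDistNeq n of x n <> y n & (forall i, (i < n)%N -> x i = y i) :
    seq_dist_spec x y n.+1%:R^-1.

Lemma seq_distP x y : seq_dist_spec x y (seq_dist x y).
Proof.
rewrite /seq_dist; case: pselect => [xy|xy]; last first.
  constructor; apply/funext => n; apply: contrapT => xyn.
  by apply: xy; exists n; apply/asboolP.
case: ex_minnP => n /asboolP xyn min_n; constructor => // i ltin.
by apply: contrapT => /asboolP /min_n; rewrite leqNgt ltin.
Qed.

Lemma seq_dist_ge x y n : x n <> y n -> n.+1%:R^-1 <= seq_dist x y.
Proof.
case: seq_distP => [-> //|m _ eq_m xyn].
rewrite lef_pV2 ?posrE ?ltr0n// ler_nat ltnS leqNgt.
by apply/negP => /eq_m.
Qed.

Lemma seq_dist_ltP x y n :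
  seq_dist x y < n.+1%:R^-1 <-> forall i, (i <= n)%N -> x i = y i.
Proof.
split=> [ltxy i lein|].
  apply: contrapT => /seq_dist_ge /le_lt_trans /(_ ltxy).
  by rewrite ltf_pV2 ?posrE ?ltr0n// ltr_nat ltnS ltnNge lein.
case: seq_distP => [_ _|m xym _ eq_n]; first by rewrite invr_gt0 ltr0n.
rewrite ltf_pV2 ?posrE ?ltr0n// ltr_nat ltnS ltnNge.
by apply/negP => /eq_n.
Qed.

Lemma seq_dist_ge0 x y : 0 <= seq_dist x y.
Proof. by case: seq_distP => // *; rewrite invr_ge0. Qed.

Lemma seq_distxx x : seq_dist x x = 0.
Proof. by case: seq_distP. Qed.

Lemma seq_dist_eq0 x y : seq_dist x y = 0 -> x = y.
Proof. by case: seq_distP => // n _ _ /eqP; rewrite invr_eq0 pnatr_eq0. Qed.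

(** At the first index [n] where [x] and [z] differ, [y] differs from one of them, so one of the two
    distances on the right is already at least [n.+1%:R^-1]. *)
Lemma seq_dist_triangle y x z : seq_dist x z <= seq_dist x y + seq_dist y z.
Proof.
case: (seq_distP x z) => [_|n xzn _]; first by rewrite addr_ge0 ?seq_dist_ge0.
have [xyn|/seq_dist_ge xyn] := pselect (x n = y n).
  by rewrite ler_wpDl ?seq_dist_ge0// seq_dist_ge// -xyn.
by rewrite ler_wpDr ?seq_dist_ge0.
Qed.

Lemma seq_dist_sym x y : seq_dist x y = seq_dist y x.
Proof.
suff le_sym u v : seq_dist u v <= seq_dist v u by apply/le_anti; rewrite !le_sym.
case: (seq_distP u v) => [_|n uvn _]; first exact: seq_dist_ge0.
by apply: seq_dist_ge; exact: nesym.
Qed.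

End sequence_metric.

(* The parameter R lets the metric be inferred from the type; an alias is
   needed since nat -> T already carries the product topology. *)
Definition discrete_seq (R : realType) (T : pointedType) := nat -> T.

Section discrete_seq.
Context {R : realType} {T : pointedType}.
Notation X := (discrete_seq R T).

HB.instance Definition _ := Pointed.copy X (nat -> T).
HB.instance Definition _ := isMetric.Build R X
  seq_distxx seq_dist_eq0 seq_dist_sym seq_dist_triangle.

Lemma ball_discrete_seqP (x y : X) n :
  ball x (n.+1%:R^-1 : R) y <-> forall i, (i <= n)%N -> x i = y i.
Proof. by rewrite ballEmdist; exact: seq_dist_ltP. Qed.

Lemma subset_ball_discrete_seq (x : X) (e : R) : 0 < e ->
  exists n, [set y : X | forall i, (i <= n)%N -> x i = y i] `<=` ball x e.
Proof.
move=> e0; have [n _ /(_ n (leqnn n)) /= ltne] := near_infty_natSinv_lt (PosNum e0).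
by exists n => y /ball_discrete_seqP; apply: le_ball; exact: ltW.
Qed.

Lemma discrete_seq_complete (F : set_system X) :
  ProperFilter F -> cauchy F -> cvg F.
Proof.
move=> FF /cauchyP Fc.
have /choice[x Fx] n : exists x : X, F (ball x (n.+1%:R^-1 : R)).
  by apply: Fc; rewrite invr_gt0.
(* The sequences that agree with [x n] up to index [n] form a member of [F], so the diagonal picks
   the eventual value of each coordinate. *)
pose l : X := fun n => x n n.
apply/cvg_ex; exists l; apply/fcvg_ballP => e /(subset_ball_discrete_seq l)[n].
move/filterS; apply.
(* The coordinates of [l] come from different centres, so the balls that fix them are intersected
   one at a time. *)
elim: n => [|n IHn].
  apply: filterS (Fx 0%N) => y /ball_discrete_seqP xy i.
  by rewrite leqn0 => /eqP->; exact: xy.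
apply: filterS2 IHn (Fx n.+1) => y ly /ball_discrete_seqP xy i.
by rewrite leq_eqVlt => /predU1P[->|]; [exact: xy|exact: ly].
Qed.

HB.instance Definition _ := Uniform_isComplete.Build X discrete_seq_complete.

Lemma nowhere_dense_discrete_seq (P : set T) (t : T) : ~ P t ->
  nowhere_dense [set x : X | forall n, P (x n)].
Proof.
move=> Pt; apply/seteqP; split=> // x.
move=> /nbhs_ballP[e /= /(subset_ball_discrete_seq x)[n xe] clP].
pose y : X := fun i => if (i <= n)%N then x i else t.
have /clP : ball x e y by apply: xe => i /= lein; rewrite /y lein.
(* This radius makes closeness to [y] fix coordinate [n.+1], the first one where [y] takes the
   forbidden value [t]. *)
have y0 : (0 : R) < n.+2%:R^-1 by rewrite invr_gt0.
move=> /(_ _ (nbhsx_ballx y _ y0))[z [/(_ n.+1) Pz /ball_discrete_seqP yz]].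
by apply: Pt; move: Pz; rewrite -yz// /y ltnn.
Qed.

End discrete_seq.

Theorem proposition4p4 (R : realType) (I I0 : set_system nat)
    (idealI : is_ideal I) (idealI0 : is_ideal I0) (PI : P_ideal I0 I) :
  ~ Baire_ideal R I.
Proof.
pose f B := [set x : discrete_seq R (set nat) |
  forall n, (I (x n) -> I0 (x n `\` B))].
move=> /(_ (discrete_seq R (set nat)) f); apply.
- move=> B /(P_ideal_unbounded PI)[C IC CB].
  by apply: (@nowhere_dense_discrete_seq _ _ [set A | I A -> I0 (A `\` B)] C) => /(_ IC).
- move=> A B _ _ AB x xA n /(xA n); apply: ideal_subset => //.
  exact: setDS.
- apply/seteqP; split=> // x _.
  (* Condition (I) needs all terms in [I]. Those outside are replaced by [set0], which loses nothing
     since [f B] puts no constraint on them. *)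
  have [n|B IB xB] := P_ideal_pseudounion PI
    (A := fun n => if `[< I (x n) >] then x n else set0).
    by case: asboolP => // _; apply: ideal_finite.
  by exists B => // n /asboolP Ixn; have := xB n; rewrite Ixn.
Qed.
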